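(* For every $\gamma\in(0,1]$ and $\alpha\geq\gamma$, the approximation ratio of the greedy algorithm on the class $\tilde{\mathcal{F}}_{\gamma,\alpha}$ of monotone, weakly $\gamma$-$\alpha$-augmentable functions is at least $\frac{\alpha}{\gamma}\cdot\frac{e^{\alpha}}{e^{\alpha}-1}$.
   Context: All functions are set functions $f\colon 2^{U}\to\mathbb{R}_{\geq0}$ on some finite ground set $U$; $f$ is monotone if $X\subseteq Y$ implies $f(X)\leq f(Y)$. Write $[n]=\{1,\dots,n\}$. For $k$, $S^{*}_{k}\in\arg\max_{X\subseteq U,|X|\leq k}f(X)$. The greedy algorithm produces $x_1,x_2,\dots$ with $x_i\in\arg\max_{x\in U\setminus\{x_1,\dots,x_{i-1}\}} f(\{x_1,\dots,x_{i-1}\}\cup\{x\})$, and $S^{G}_i=\{x_1,\dots,x_i\}$, $S^{G}_0=\emptyset$; ties are broken by some rule, and each function is considered together with a fixed such greedy run, to which all notions referring to greedy sets refer. $\bar{k}\in[|U|]$ is the smallest index such that $f(S^{G}_{\bar k}\cup\{x\})=f(S^{G}_{\bar k})$ for all $x\in U\setminus S^{G}_{\bar k}$. For $\gamma\in(0,1]$, $\alpha\geq\gamma$, $f$ is weakly $\gamma$-$\alpha$-augmentable if for all $X\in\{S^{G}_0,\dots,S^{G}_{\bar k}\}$ and all $Y\subseteq U$ with $Y\nsubseteq X$ there is $y\in Y$ with $f(X\cup\{y\})-f(X)\geq\frac{\gamma f(X\cup Y)-\alpha f(X)}{|Y|}$. $\tilde{\mathcal{F}}_{\gamma,\alpha}$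 is the set of monotone weakly $\gamma$-$\alpha$-augmentable functions (each with its greedy run). The approximation ratio of the greedy algorithm on a class $\mathcal{F}$ is $\sup_{f\in\mathcal{F}}\max_{k\in[|U|]} f(S^{*}_{k})/f(S^{G}_{k})$. *)

(* Defs.v *)
From HB Require Import structures.
From mathcomp Require Import all_boot all_order all_algebra.
From mathcomp Require Import boolp classical_sets reals constructive_ereal ereal.
From mathcomp Require Import sequences exp.

Set Implicit Arguments.
Unset Strict Implicit.
Unset Printing Implicit Defensive.

Import Order.TTheory GRing.Theory Num.Theory.
Local Open Scope ring_scope.
Local Open Scope set_scope.

(* Runs are indexed from 0: [x j] is the element x_{j+1} chosen in round j+1. *)
Definition greedy_set (U : finType) (x : 'I_#|U| -> U) (i : nat) : {set U} :=
  [set x j | j : 'I_#|U| & (j < i)%N].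

Definition greedy_run (R : realType) (U : finType) (f : {set U} -> R)
    (x : 'I_#|U| -> U) : Prop :=
  forall i : 'I_#|U|,
    x i \notin greedy_set x i /\
    forall y, y \notin greedy_set x i ->
      f (greedy_set x i :|: [set y]) <= f (greedy_set x i :|: [set x i]).

(* A nonnegative set function together with its fixed greedy run. The ground
   set is nonempty because kbar below has to lie in {1, ..., #|U|}. *)
Record instance (R : realType) : Type := Instance {
  ground : finType;
  objective : {set ground} -> R;
  run : 'I_#|ground| -> ground;
  ground_gt0 : (0 < #|ground|)%N;
  objective_ge0 : forall X, 0 <= objective X;
  runP : greedy_run objective run
}.

Definition SG (R : realType) (I : instance R) (i : nat) : {set ground I} :=
  greedy_set (@run R I) i.

Definition stationary (R : realType) (I : instance R) (k : nat) : bool :=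
  [forall x : ground I, (x \notin SG I k) ==>
     (objective (SG I k :|: [set x]) == objective (SG I k))].

Lemma run_inj (R : realType) (I : instance R) : injective (@run R I).
Proof.
have H (i j : 'I_#|ground I|) : (i < j)%N -> run i <> run j.
  move=> ij E; have [/negP[]] := runP j.
  by rewrite -E /greedy_set; apply: imset_f; rewrite inE.
by move=> i j E; apply/val_inj; case: (ltngtP i j) => // /H; rewrite E.
Qed.

Lemma exists_stationary (R : realType) (I : instance R) :
  exists k, (1 <= k <= #|ground I|)%N && stationary I k.
Proof.
exists #|ground I|; rewrite ground_gt0 leqnn /=.
suff -> : stationary I #|ground I| = true by [].
apply/forallP => y; apply/implyP => /negP[].
have /subset_cardP : #|codom (@run R I)| = #|ground I|.
  by rewrite (card_codom (@run_inj R I)) card_ord.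
move=> /(_ (subset_predT _)) /(_ y).
rewrite inE => /codomP[j ->].
by apply: imset_f; rewrite inE ltn_ord.
Qed.

Definition kbar (R : realType) (I : instance R) : nat :=
  ex_minn (exists_stationary I).

Definition monotone (R : realType) (I : instance R) : Prop :=
  forall X Y : {set ground I}, X \subset Y -> objective X <= objective Y.

Definition weakly_augmentable (R : realType) (gamma alpha : R)
    (I : instance R) : Prop :=
  forall i : nat, (i <= kbar I)%N ->
  forall Y : {set ground I}, ~~ (Y \subset SG I i) ->
  exists2 y, y \in Y &
    (gamma * objective (SG I i :|: Y) - alpha * objective (SG I i)) / #|Y|%:R
      <= objective (SG I i :|: [set y]) - objective (SG I i).

Definition Ftilde (R : realType) (gamma alpha : R) (I : instance R) : Prop :=
  monotone I /\ weakly_augmentable gamma alpha I.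

Definition Sstar (R : realType) (I : instance R) (k : nat) : {set ground I} :=
  [arg max_(X > finset.set0 | (#|X| <= k)%N) objective X]%O.

(* Division in the extended reals: a / 0 = +oo for a > 0, and 0 / 0 = 0. *)
Definition greedy_ratio (R : realType) (I : instance R) : \bar R :=
  \big[Order.max/-oo%E]_(1 <= k < #|ground I|.+1)
    ((objective (Sstar I k))%:E / (objective (SG I k))%:E)%E.

(* Classes are predicates rather than [set (instance R)]: [instance R] lives in
   a universe too large for [set]. *)
Definition approx_ratio (R : realType) (F : instance R -> Prop) : \bar R :=
  ereal_sup [set r | exists2 I, F I & greedy_ratio I = r]%classic.

(* Main.v *)
Require Import Defs.
From mathcomp Require Import all_boot all_order all_algebra.
From mathcomp Require Import boolp classical_sets reals constructive_ereal ereal.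
From mathcomp Require Import sequences exp.
From mathcomp Require Import normedtype fintype finset.
From mathcomp Require Import lra ring.

Set Implicit Arguments.
Unset Strict Implicit.
Unset Printing Implicit Defensive.

Import Order.TTheory GRing.Theory Num.Theory.
Import numFieldNormedType.Exports.
Local Open Scope ring_scope.

(** Plant a block of [k] elements in a larger ground set: [X] has value 1 if it
    contains the block, and [F #|X|] otherwise.  An incomplete block is worth no
    more than any other set of its size, so ties let greedy avoid the block at
    first, and the ratio at size [k] is at least [1 / F k].  Augmentability by
    the whole block asks that [gamma - alpha * F i <= k * (F i.+1 - F i)], whose
    continuous extremal solution is
    [gamma / alpha * (1 - expR (- alpha * i / k))].  Multiplying it by
    [1 + alpha / k] makes up for the discretization, and also makes it exceed
    [gamma / alpha] from some round on.  Capped there, it leaves greedy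
    stationary, and augmentability asks nothing of the greedy sets of later
    rounds. *)

Section ConcaveSequence.
Variable R : realDomainType.
Implicit Types F : nat -> R.

Definition concave_seq F : Prop := forall i, F i + F i.+2 <= F i.+1 *+ 2.

Lemma concave_seq_le_chord F i n :
  concave_seq F -> F (i + n)%N - F i <= (F i.+1 - F i) *+ n.
Proof.
move=> F_concave.
have le_first_increment j : F (i + j).+1 - F (i + j)%N <= F i.+1 - F i.
  elim: j => [|j IHj]; first by rewrite addn0.
  by rewrite addnS; have := F_concave (i + j)%N; lra.
elim: n => [|n IHn]; first by rewrite addn0 subrr.
by rewrite addnS mulrSr; have := le_first_increment n; lra.
Qed.

Lemma concave_seqZ a F :
  0 <= a -> concave_seq F -> concave_seq (fun i => a * F i).
Proof.
by move=> a_ge0 F_concave i; rewrite -mulrDr -mulrnAr ler_wpM2l.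
Qed.

Lemma concave_seq_min a F :
  concave_seq F -> concave_seq (fun i => Num.min a (F i)).
Proof.
move=> F_concave i; have [a_le|lt_a] := leP a (F i.+1).
  by rewrite mulr2n lerD // ge_min lexx.
by apply: le_trans (F_concave i); rewrite lerD // ge_min lexx orbT.
Qed.

End ConcaveSequence.

Section CappedGeometric.
Variables (R : realFieldType) (a q : R).
Hypotheses (a_ge1 : 1 <= a) (q_ge0 : 0 <= q) (q_le1 : q <= 1).

Definition capped_geometric (i : nat) : R := Num.min 1 (a * (1 - q ^+ i)).

Let a_ge0 : 0 <= a. Proof. exact: le_trans ler01 a_ge1. Qed.

Lemma capped_geometric_ge0 i : 0 <= capped_geometric i.
Proof. by rewrite le_min ler01 mulr_ge0 // subr_ge0 exprn_ile1. Qed.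

Lemma capped_geometric_le1 i : capped_geometric i <= 1.
Proof. by rewrite ge_min lexx. Qed.

Lemma capped_geometric_le i : capped_geometric i <= a * (1 - q ^+ i).
Proof. by rewrite ge_min lexx orbT. Qed.

Lemma capped_geometric_homo :
  {homo capped_geometric : i j / (i <= j)%N >-> i <= j}.
Proof.
by move=> i j le_ij; rewrite le_min2 // ler_wpM2l // lerB // ler_wiXn2l.
Qed.

Lemma capped_geometric_concave : concave_seq capped_geometric.
Proof.
apply/concave_seq_min/concave_seqZ => // i /=; rewrite !exprS.
have := mulr_ge0 (exprn_ge0 i q_ge0) (sqr_ge0 (1 - q)).
by move: (q ^+ i) => t; lra.
Qed.

Lemma capped_geometric_increment u i :
  0 <= u <= 1 -> u <= a * (1 - q) ->
  u * (1 - capped_geometric i) <= capped_geometric i.+1 - capped_geometric i.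
Proof.
move=> /andP[u_ge0 u_le1] u_le.
have := capped_geometric_homo (leqnSn i).
have t_ge0 : 0 <= q ^+ i by exact: exprn_ge0.
have t_le1 : q ^+ i <= 1 by exact: exprn_ile1.
rewrite /capped_geometric exprS; move: (q ^+ i) t_ge0 t_le1 => t t_ge0 t_le1.
have [_ ?|lt1] := leP 1 (a * (1 - t)); first lra.
have [_ _|_ _] := leP 1 (a * (1 - q * t)).
  by rewrite ler_piMl // subr_ge0 ltW.
have le_ut : u * (1 - a * (1 - t)) <= u * t.
  have : 0 <= (a - 1) * (1 - t) by rewrite mulr_ge0 ?subr_ge0.
  by move=> ?; rewrite ler_wpM2l //; lra.
by apply: le_trans le_ut _; have := ler_wpM2r t_ge0 u_le; lra.
Qed.

Lemma capped_geometric_gt0 i : (0 < i)%N -> q < 1 -> 0 < capped_geometric i.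
Proof.
move=> i_gt0 q_lt1; rewrite lt_min ltr01 mulr_gt0 //.
  exact: lt_le_trans a_ge1.
by rewrite subr_gt0 exprn_ilt1 // -lt0n.
Qed.

End CappedGeometric.

Lemma capped_geometric_eventually1 (R : archiRealFieldType) (a q : R) :
  1 < a -> 0 <= q < 1 ->
  exists n, forall i, (n <= i)%N -> capped_geometric a q i = 1.
Proof.
move=> a_gt1 /andP[q_ge0 q_lt1]; have a_gt0 : 0 < a by exact: lt_trans a_gt1.
have q_norm : `|q| < 1 by rewrite ger0_norm.
have e_gt0 : 0 < (a - 1) / a by rewrite divr_gt0 ?subr_gt0.
have /cvgr0_norm_lt /(_ _ e_gt0) [n _ small] := cvg_expr q_norm.
exists n => i /small /=; rewrite ger0_norm ?exprn_ge0 // ltr_pdivlMr // => ?.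
by apply/min_idPl; lra.
Qed.

Section GreedySet.
Variables (U : finType) (x : 'I_#|U| -> U).
Hypothesis x_inj : injective x.

Lemma mem_greedy_set (j : 'I_#|U|) i : (x j \in greedy_set x i) = (j < i)%N.
Proof. by rewrite mem_imset // inE. Qed.

Lemma card_greedy_set i : (i <= #|U|)%N -> #|greedy_set x i| = i.
Proof.
move=> le_iU; rewrite card_imset // -sum1_card.
rewrite (eq_bigl (fun j : 'I__ => (j < i)%N)) => [|j]; last by rewrite inE.
by rewrite -(big_ord_widen _ (fun=> 1%N)) // sum1_card card_ord.
Qed.

End GreedySet.

Lemma subset_disjointU1 (U : finType) (A X : {set U}) y :
  (1 < #|A|)%N -> [disjoint A & X] -> (A \subset X :|: [set y]) = false.
Proof.
move=> A_gt1 disAX; rewrite -subDset (setDidPl disAX); apply: contraTF A_gt1.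
by move=> /subset_leq_card; rewrite cards1 -leqNgt.
Qed.

Section Planted.
Variables (R : realDomainType) (U : finType) (B : {set U}) (F : nat -> R).
Implicit Types X Y : {set U}.

Definition planted X : R := if B \subset X then 1 else F #|X|.

Lemma planted_ge0 : (forall i, 0 <= F i) -> forall X, 0 <= planted X.
Proof. by move=> F_ge0 X; rewrite /planted; case: ifP. Qed.

Lemma planted_block : planted B = 1.
Proof. by rewrite /planted subxx. Qed.

Lemma planted_le_planted X Y :
  (forall i, F i <= 1) -> {homo F : i j / (i <= j)%N >-> i <= j} ->
  (#|X| <= #|Y|)%N -> (B \subset X -> B \subset Y) -> planted X <= planted Y.
Proof.
move=> F_le1 F_homo le_XY; rewrite /planted.
case: ifP => [_ /(_ isT) ->|_ _] //.
by case: ifP => // _; apply: F_homo.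
Qed.

Lemma planted_disjoint X :
  (0 < #|B|)%N -> [disjoint B & X] -> planted X = F #|X|.
Proof.
move=> B_gt0 disBX; rewrite /planted; case: ifP => // subBX; move: disBX.
by rewrite -setI_eq0 (setIidPl subBX) -cards_eq0 gtn_eqF.
Qed.

Section DisjointFromBlock.
Variable X : {set U}.
Hypotheses (B_gt1 : (1 < #|B|)%N) (disBX : [disjoint B & X]).

Lemma planted_disjointU1 y : y \notin X -> planted (X :|: [set y]) = F #|X|.+1.
Proof.
by move=> yX; rewrite /planted subset_disjointU1 // setUC cardsU1 yX.
Qed.

Lemma planted_augment (gamma alpha : R) Y y :
  0 <= gamma <= 1 -> gamma <= alpha -> (forall i, 0 <= F i) ->
  {homo F : i j / (i <= j)%N >-> i <= j} -> concave_seq F ->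
  gamma - alpha * F #|X| <= (F #|X|.+1 - F #|X|) *+ #|B| ->
  y \notin X ->
  gamma * planted (X :|: Y) - alpha * planted X
    <= (planted (X :|: [set y]) - planted X) *+ #|Y|.
Proof.
move=> /andP[gamma_ge0 gamma_le1] le_ga F_ge0 F_homo F_concave gain_block yX.
rewrite planted_disjointU1 // (@planted_disjoint X) ?(ltnW B_gt1) // /planted.
have [|_] := boolP (B \subset _).
  rewrite -subDset (setDidPl disBX) mulr1 => /subset_leq_card le_BY.
  by apply: le_trans gain_block _; rewrite ler_wpMn2l // subr_ge0 F_homo.
apply: le_trans (concave_seq_le_chord _ #|Y| F_concave).
have le_F : F #|X :|: Y| <= F (#|X| + #|Y|)%N.
  by rewrite F_homo // leq_card_setU.
apply: (@le_trans _ _ (gamma * (F (#|X| + #|Y|)%N - F #|X|))).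
  by rewrite mulrBr lerB ?ler_wpM2l ?ler_wpM2r.
by rewrite ler_piMl // subr_ge0 F_homo // leq_addr.
Qed.

End DisjointFromBlock.

End Planted.

Section GreedyOfInstance.
Variables (R : realType) (I : instance R).

Lemma kbar_le k :
  (0 < k <= #|ground I|)%N -> stationary I k -> (kbar I <= k)%N.
Proof.
move=> k_range stat_k; rewrite /kbar; case: ex_minnP => m _; apply.
exact/andP.
Qed.

Lemma objective_le_Sstar k (A : {set ground I}) :
  (#|A| <= k)%N -> objective A <= objective (Sstar I k).
Proof.
rewrite /Sstar; case: arg_maxP => [|Y _ maxY]; first by rewrite cards0.
exact: maxY.
Qed.

Lemma le_greedy_ratio k (A : {set ground I}) :
  (0 < k <= #|ground I|)%N -> (#|A| <= k)%N -> 0 < objective (SG I k) ->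
  ((objective A / objective (SG I k))%:E <= greedy_ratio I)%E.
Proof.
move=> k_range le_Ak SG_gt0; rewrite /greedy_ratio.
apply: (@Order.TotalTheory.bigmax_sup_seq _ _ _ _ _ k) => //.
  by rewrite mem_index_iota.
rewrite inver gt_eqF // -EFinM lee_fin ler_pM2r ?invr_gt0 //.
exact: objective_le_Sstar.
Qed.

End GreedyOfInstance.

Section PlantedInstance.
Variables (R : realType) (U : finType) (x : 'I_#|U| -> U) (F : nat -> R).
Variable N : nat.
Hypotheses (x_inj : injective x) (N_lt : (N.+1 < #|U|)%N).
Hypotheses (F_ge0 : forall i, 0 <= F i) (F_le1 : forall i, F i <= 1).
Hypothesis F_homo : {homo F : i j / (i <= j)%N >-> i <= j}.

Let B := ~: greedy_set x N.

Let le_NU : (N <= #|U|)%N. Proof. exact: ltnW (ltnW N_lt). Qed.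

Lemma card_planted_block : #|B| = (#|U| - N)%N.
Proof. by rewrite cardsCs setCK card_greedy_set. Qed.

Let B_gt1 : (1 < #|B|)%N.
Proof. by rewrite card_planted_block ltn_subRL addn1. Qed.

Lemma planted_block_disjoint i : (i <= N)%N -> [disjoint B & greedy_set x i].
Proof.
move=> le_iN; rewrite disjoint_sym disjoints_subset setCK.
by apply: imsetS; apply/subsetP => j; rewrite !inE => /leq_trans->.
Qed.

Lemma planted_greedy_run : greedy_run (planted B F) x.
Proof.
move=> i; have xi : x i \notin greedy_set x i by rewrite mem_greedy_set ?ltnn.
split=> // y yi; apply: planted_le_planted => // [|sub].
  by rewrite !(setUC (greedy_set _ _)) !cardsU1 xi yi.
suff : x i \in greedy_set x i :|: [set y].
  by rewrite in_setU (negPf xi) in_set1 => /eqP->.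
have [lt_iN|le_Ni] := ltnP i N.
  by rewrite subset_disjointU1 ?planted_block_disjoint ?(ltnW lt_iN) in sub.
by apply: (subsetP sub); rewrite inE mem_greedy_set // -leqNgt.
Qed.

Let U_gt0 : (0 < #|U|)%N. Proof. exact: leq_ltn_trans N_lt. Qed.

Definition planted_instance : instance R :=
  Instance U_gt0 (planted_ge0 B F_ge0) planted_greedy_run.

Lemma objective_SG_planted i :
  (i <= N)%N -> objective (SG planted_instance i) = F i.
Proof.
move=> le_iN.
rewrite /= planted_disjoint ?planted_block_disjoint ?(ltnW B_gt1) //.
by rewrite card_greedy_set // (leq_trans le_iN).
Qed.

Lemma planted_instance_monotone : monotone planted_instance.
Proof.
move=> X Y subXY; apply: planted_le_planted => //; first exact: subset_leq_card.
by move=> /subset_trans; apply.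
Qed.

Lemma kbar_planted :
  (0 < N)%N -> F N.+1 = F N -> (kbar planted_instance <= N)%N.
Proof.
move=> N_gt0 F_stat; apply: kbar_le; first by rewrite N_gt0.
apply/forallP => y; apply/implyP => yN; rewrite objective_SG_planted //=.
rewrite planted_disjointU1 ?planted_block_disjoint //.
by rewrite card_greedy_set ?F_stat.
Qed.

Lemma planted_instance_augmentable gamma alpha :
  (0 < N)%N -> F N.+1 = F N -> 0 <= gamma <= 1 -> gamma <= alpha ->
  concave_seq F ->
  (forall i, gamma - alpha * F i <= (F i.+1 - F i) *+ (#|U| - N)) ->
  weakly_augmentable gamma alpha planted_instance.
Proof.
move=> N_gt0 F_stat gamma01 le_ga F_concave F_gain i.
move=> /leq_trans/(_ (kbar_planted N_gt0 F_stat)) le_iN Y /subsetPn[y yY yi].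
exists y => //; have Y_gt0 : (0 < #|Y|)%N by apply/card_gt0P; exists y.
rewrite ler_pdivrMr ?ltr0n // mulr_natr.
apply: planted_augment => //; first exact: planted_block_disjoint.
by rewrite card_planted_block.
Qed.

Lemma le_greedy_ratio_planted :
  (#|U| - N <= N)%N -> 0 < F (#|U| - N)%N ->
  ((F (#|U| - N)%N)^-1%:E <= greedy_ratio planted_instance)%E.
Proof.
move=> le_kN F_gt0; have := @le_greedy_ratio _ planted_instance (#|U| - N) B.
rewrite objective_SG_planted //= planted_block div1r; apply => //.
  by rewrite subn_gt0 (ltnW N_lt) leq_subr.
by rewrite card_planted_block.
Qed.

End PlantedInstance.

Lemma approx_ratio_ge_planted (R : realType) (gamma alpha : R) (F : nat -> R)
    (N k : nat) :
  0 <= gamma <= 1 -> gamma <= alpha -> (1 < k <= N)%N ->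
  (forall i, 0 <= F i) -> (forall i, F i <= 1) ->
  {homo F : i j / (i <= j)%N >-> i <= j} -> concave_seq F -> F N.+1 = F N ->
  (forall i, gamma - alpha * F i <= (F i.+1 - F i) *+ k) -> 0 < F k ->
  ((F k)^-1%:E <= approx_ratio (Ftilde gamma alpha))%E.
Proof.
move=> gamma01 le_ga /andP[k_gt1 le_kN] F_ge0 F_le1 F_homo F_concave F_stat.
move=> F_gain Fk_gt0.
have card_block : (#|'I_(N + k)| - N)%N = k by rewrite card_ord addKn.
have N_lt : (N.+1 < #|'I_(N + k)|)%N by rewrite card_ord -addn1 ltn_add2l.
apply: (@le_trans _ _ (greedy_ratio
    (planted_instance (@enum_val_inj _ 'I_(N + k)) N_lt F_ge0 F_le1 F_homo))).
  have := le_greedy_ratio_planted enum_val_inj N_lt F_ge0 F_le1 F_homo.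
  by rewrite card_block; apply.
apply: ereal_sup_ubound; eexists; last by []; split.
  exact: planted_instance_monotone.
apply: planted_instance_augmentable => //; last by rewrite card_block.
by apply: leq_trans le_kN; rewrite ltnW.
Qed.

Lemma approx_ratio_ge_capped_geometric (R : realType) (gamma alpha a q : R)
    (k : nat) :
  0 < gamma <= 1 -> gamma <= alpha -> (1 < k)%N -> alpha <= k%:R ->
  1 < a -> 0 <= q < 1 -> alpha / k%:R <= a * (1 - q) ->
  ((alpha / gamma / (a * (1 - q ^+ k)))%:E
     <= approx_ratio (Ftilde gamma alpha))%E.
Proof.
move=> /andP[gamma_gt0 gamma_le1] le_ga k_gt1 le_ak a_gt1 q01 le_uq.
have [n g_eq1] := capped_geometric_eventually1 a_gt1 q01.
have /andP[q_ge0 q_lt1] := q01; have [a_ge1 q_le1] := (ltW a_gt1, ltW q_lt1).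
have alpha_gt0 : 0 < alpha by exact: lt_le_trans le_ga.
have k_gt0 : 0 < k%:R :> R by rewrite ltr0n ltnW.
pose L := gamma / alpha; pose g := capped_geometric a q.
have L_gt0 : 0 < L by rewrite divr_gt0.
have L_le1 : L <= 1 by rewrite ler_pdivrMr ?mul1r.
have Lg_gt0 : 0 < L * g k by rewrite mulr_gt0 ?capped_geometric_gt0 // ltnW.
have Lg_le : L * g k <= L * (a * (1 - q ^+ k)).
  by rewrite ler_pM2l // capped_geometric_le.
have g_gain i : alpha / k%:R * (1 - g i) <= g i.+1 - g i.
  apply: capped_geometric_increment => //.
  by rewrite divr_ge0 ?(ltW alpha_gt0) ?(ltW k_gt0) //= ler_pdivrMr ?mul1r.
apply: (@le_trans _ _ (L * g k)^-1%:E).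
  rewrite lee_fin -[alpha / gamma]invf_div -invfM lef_pV2 ?posrE //.
  exact: lt_le_trans Lg_le.
apply: (@approx_ratio_ge_planted _ _ _ (fun i => L * g i) (maxn n k)) => //.
- by rewrite ltW.
- by rewrite k_gt1 leq_maxr.
- by move=> i; rewrite mulr_ge0 ?capped_geometric_ge0 // ltW.
- move=> i; rewrite mulr_ile1 ?capped_geometric_ge0 ?capped_geometric_le1 //.
  exact: ltW.
- by move=> i j le_ij; rewrite ler_pM2l // capped_geometric_homo.
- by apply: concave_seqZ; [exact: ltW | exact: capped_geometric_concave].
- by rewrite /g !g_eq1 ?leqW ?leq_maxl.
move=> i; rewrite -mulrBr -mulrnAr -mulr_natl.
have -> : gamma - alpha * (L * g i) = L * (k%:R * (alpha / k%:R * (1 - g i))).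
  by rewrite /L; field; rewrite !gt_eqF.
by rewrite ler_pM2l // ler_pM2l.
Qed.

Lemma le_mul1D_onem_expRN (R : realType) (u : R) :
  u <= (1 + u) * (1 - expR (- u)).
Proof.
have : (1 + u) / expR u <= 1.
  by rewrite ler_pdivrMr ?expR_gt0 // mul1r expR_ge1Dx.
by rewrite expRN; lra.
Qed.

Lemma approx_ratio_ge_expR (R : realType) (gamma alpha : R) (k : nat) :
  0 < gamma <= 1 -> gamma <= alpha -> (1 < k)%N -> alpha <= k%:R ->
  ((alpha / gamma * (expR alpha / (expR alpha - 1)) / (1 + alpha / k%:R))%:E
     <= approx_ratio (Ftilde gamma alpha))%E.
Proof.
move=> gamma01 le_ga k_gt1 le_ak; have /andP[gamma_gt0 _] := gamma01.
have alpha_gt0 : 0 < alpha by exact: lt_le_trans le_ga.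
have k_gt0 : 0 < k%:R :> R by rewrite ltr0n ltnW.
set u := alpha / k%:R; have u_gt0 : 0 < u by rewrite divr_gt0.
have -> : alpha / gamma * (expR alpha / (expR alpha - 1)) / (1 + u) =
    alpha / gamma / ((1 + u) * (1 - expR (- u) ^+ k)).
  have -> : expR (- u) ^+ k = (expR alpha)^-1.
    by rewrite -expRM_natl mulrN mulrC /u divfK ?gt_eqF // expRN.
  have E_gt1 : 1 < expR alpha by rewrite expR_gt1.
  by field; rewrite !gt_eqF //; lra.
apply: approx_ratio_ge_capped_geometric => //; first by rewrite ltrDl.
  by rewrite expR_ge0 expR_lt1 oppr_lt0.
exact: le_mul1D_onem_expRN.
Qed.

Theorem theorem23 (R : realType) (gamma alpha : R)
    (gamma_gt0 : 0 < gamma) (gamma_le1 : gamma <= 1)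
    (gamma_le_alpha : gamma <= alpha) :
  ((alpha / gamma * (expR alpha / (expR alpha - 1)))%:E
     <= approx_ratio (Ftilde gamma alpha))%E.
Proof.
have alpha_gt0 : 0 < alpha by exact: lt_le_trans gamma_le_alpha.
set ratio := alpha / gamma * _.
have ratio_ge0 : 0 <= ratio.
  apply: mulr_ge0; first by rewrite divr_ge0 ?ltW.
  by rewrite divr_ge0 ?expR_ge0 // subr_ge0 ltW // expR_gt1.
apply/lee_mul01Pr => [|r /andP[r_gt0 r_lt1]]; first by rewrite lee_fin.
pose k := (Num.bound (alpha / (1 - r))).+2.
have k_gt0 : 0 < k%:R :> R by rewrite ltr0n.
have lt_u : alpha / k%:R < 1 - r.
  rewrite ltr_pdivrMr // mulrC -ltr_pdivrMr ?subr_gt0 //.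
  apply: lt_trans (archi_boundP _) _; last by rewrite ltr_nat /k.
  by rewrite divr_ge0 ?subr_ge0 // ltW.
have le_alpha_k : alpha <= k%:R.
  by rewrite -[leRHS]mul1r -ler_pdivrMr //; lra.
have u_gt0 : 0 < alpha / k%:R by rewrite divr_gt0.
apply: le_trans (approx_ratio_ge_expR _ gamma_le_alpha _ le_alpha_k) => //.
  rewrite -EFinM lee_fin mulrC ler_wpM2l //.
  by rewrite -[leRHS]div1r ler_pdivlMr; [nra | lra].
by rewrite gamma_gt0.
Qed.
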